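(* Let $H$ be a complex Hilbert space, let $V$ be the real vector space of bounded self-adjoint operators on $H$, let $V^+\subset V$ be the cone of positive semi-definite operators, and let $e=\mathbb{1}$ be the identity operator. Let $F\in V$ with $0\le F\le \mathbb{1}$. Then $F$ admits a coherent Lüders's rule if and only if $F$ is a projection ($F^2=F$). Moreover, if $F$ is a projection, then the coherent Lüders's rule for $F$ is unique and is given by $F^\sharp\colon V\to V$, $X\mapsto FXF$.
   Context: The order on $V$ is the usual operator order: $X\ge Y$ iff $X-Y\in V^+$. A coherent Lüders's rule for an effect $F$ (an element with $0\le F\le \mathbb{1}$) is a real-linear map $\phi\colon V\to V$ that is positive ($\phi(V^+)\subset V^+$), satisfies $\phi(\mathbb{1})=F$, and satisfies $\phi(G)=G$ for every $G\in V^+$ with $G\le F$. No complete positivity or continuity is assumed. *)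

(* Defs.v *)
From HB Require Import structures.
From mathcomp Require Import all_boot all_order all_algebra.
From mathcomp Require Import complex.
From mathcomp Require Import all_classical all_reals all_analysis.

Set Implicit Arguments.
Unset Strict Implicit.
Unset Printing Implicit Defensive.

Import Order.TTheory GRing.Theory Num.Theory.
Import numFieldNormedType.Exports.

Local Open Scope classical_set_scope.
Local Open Scope ring_scope.
Local Open Scope complex_scope.

(* The inner product is linear in its first argument and conjugate-linear in
   the second; completeness comes from completeNormedModType, whose norm is
   R[i]-valued (with real values). *)
HB.mixin Record CompleteNormedModule_isHilbert (R : realType) H
    of CompleteNormedModule R[i] H := {
  inner : {dot H for @Num.conj R[i]};
  sqr_norm_inner : forall x : H, `|x| ^+ 2 = inner x x
}.

#[short(type="hilbertType")]
HB.structure Definition Hilbert (R : realType) :=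
  {H of CompleteNormedModule R[i] H & CompleteNormedModule_isHilbert R H}.

Definition bounded_op (R : realType) (H : hilbertType R) (f : H -> H) : Prop :=
  exists M : R, forall x : H, `|f x| <= M%:C * `|x|.

Definition selfadjoint (R : realType) (H : hilbertType R) (f : H -> H) : Prop :=
  forall x y : H, inner (f x) y = inner x (f y).

Definition bounded_sa (R : realType) (H : hilbertType R) : pred (H -> H) :=
  fun f => `[< [/\ linear f, bounded_op f & selfadjoint f] >].

Record sa_op (R : realType) (H : hilbertType R) := SAOp {
  sa_fun :> H -> H;
  sa_funP : bounded_sa sa_fun
}.

Section SelfAdjointModule.
Variables (R : realType) (H : hilbertType R).

Lemma bounded_saP (f : H -> H) :
  bounded_sa f <-> [/\ linear f, bounded_op f & selfadjoint f].
Proof. by split => [/asboolP|?]; [|apply/asboolP]. Qed.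

Lemma bounded_sa_zmod_closed : zmod_closed (@bounded_sa R H).
Proof.
split=> [|f g /bounded_saP[lf [M fM] sf] /bounded_saP[lg [N gN] sg]].
  apply/bounded_saP; split.
  - by move=> a x y; rewrite /= scaler0 addr0.
  - by exists 0 => x; rewrite normr0 mul0r.
  - by move=> x y; rewrite /= linear0l linear0r.
apply/bounded_saP; split.
- move=> a x y.
  change (f (a *: x + y) - g (a *: x + y) = a *: (f x - g x) + (f y - g y)).
  by rewrite lf lg scalerBr opprD addrACA.
- exists (M + N) => x; rewrite rmorphD /= mulrDl.
  by apply: (le_trans (ler_normB _ _)); exact: lerD.
- move=> x y.
  change (inner (f x - g x) y = inner x (f y - g y)).
  by rewrite linearBl linearBr /= sf sg.
Qed.

HB.instance Definition _ :=
  GRing.isZmodClosed.Build (H -> H) (@bounded_sa R H) bounded_sa_zmod_closed.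

HB.instance Definition _ := [isSub for @sa_fun R H].
HB.instance Definition _ := [Choice of sa_op H by <:].
HB.instance Definition _ := [SubChoice_isSubZmodule of sa_op H by <:].

Lemma bounded_sa_scale (r : R) (X : sa_op H) :
  bounded_sa (fun x : H => r%:C *: X x).
Proof.
case: X => f /= /bounded_saP[lf [M fM] sf]; apply/bounded_saP; split.
- by move=> a x y; rewrite lf scalerDr !scalerA mulrC.
- exists (`|r| * M) => x.
  by rewrite normrZ normc_def /= expr0n addr0 sqrtr_sqr rmorphM -mulrA
    ler_wpM2l// lecR.
- move=> x y; rewrite linearZl_LR linearZr_LR /= sf.
  by congr (_ * _); exact/esym/conjc_real.
Qed.

Definition sa_scale (r : R) (X : sa_op H) : sa_op H :=
  SAOp (bounded_sa_scale r X).

Lemma sa_scaleA (a b : R) (X : sa_op H) :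
  sa_scale a (sa_scale b X) = sa_scale (a * b) X.
Proof. by apply/val_inj/funext => x; rewrite /= scalerA rmorphM. Qed.

Lemma sa_scale1 : left_id 1 sa_scale.
Proof. by move=> X; apply/val_inj/funext => x; rewrite /= scale1r. Qed.

Lemma sa_scaleDr : right_distributive sa_scale +%R.
Proof. by move=> a X Y; apply/val_inj/funext => x; exact: scalerDr. Qed.

Lemma sa_scaleDl (X : sa_op H) : {morph sa_scale^~ X : a b / a + b}.
Proof.
move=> a b; apply/val_inj/funext => x.
change ((a + b)%:C *: X x = a%:C *: X x + b%:C *: X x).
by rewrite rmorphD scalerDl.
Qed.

HB.instance Definition _ := GRing.Zmodule_isLmodule.Build R (sa_op H)
  sa_scaleA sa_scale1 sa_scaleDr sa_scaleDl.

End SelfAdjointModule.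

Section CoherentLuders.
Variables (R : realType) (H : hilbertType R).

Lemma bounded_sa_id : bounded_sa (@id H).
Proof. by apply/bounded_saP; split=> //; exists 1 => x; rewrite mul1r. Qed.

Definition sa_one : sa_op H := SAOp bounded_sa_id.

(* In R[i], [0 <= z] means that z is real and nonnegative. *)
Definition sa_pos : set (sa_op H) := [set X | forall x : H, 0 <= inner (X x) x].

Definition sa_le (X Y : sa_op H) : Prop := sa_pos (Y - X).

Definition is_effect (F : sa_op H) : Prop := sa_le 0 F /\ sa_le F sa_one.

Definition is_projection (F : sa_op H) : Prop := F \o F = F :> (H -> H).

Definition coherent_luders (F : sa_op H) (phi : sa_op H -> sa_op H) : Prop :=
  [/\ linear phi,
      forall X, sa_pos X -> sa_pos (phi X),
      phi sa_one = F &
      forall G, sa_pos G -> sa_le G F -> phi G = G].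

Lemma bounded_sa_sharp (F X : sa_op H) : bounded_sa (F \o X \o F).
Proof.
case: F X => f /= /bounded_saP[lf [M fM] sf] [g /= /bounded_saP[lg [N gN] sg]].
apply/bounded_saP; split.
- by move=> a x y; rewrite /= lf lg lf.
- have aM (K : R) (z : H) : K%:C * `|z| <= `|K|%:C * `|z|.
    by rewrite ler_wpM2r// lecR ler_norm.
  have fM' z : `|f z| <= `|M|%:C * `|z| := le_trans (fM z) (aM M z).
  have gN' z : `|g z| <= `|N|%:C * `|z| := le_trans (gN z) (aM N z).
  exists (`|M| * `|N| * `|M|) => x; rewrite /= !rmorphM /= -!mulrA.
  apply: (le_trans (fM' _)); rewrite ler_wpM2l ?lecR//.
  by apply: (le_trans (gN' _)); rewrite ler_wpM2l ?lecR.
- by move=> x y; rewrite /= sf sg sf.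
Qed.

Definition sharp (F : sa_op H) : sa_op H -> sa_op H :=
  fun X => SAOp (bounded_sa_sharp F X).

End CoherentLuders.

Arguments sa_one {R} H.

(* Main.v *)
Require Import Defs.
From HB Require Import structures.
From mathcomp Require Import all_boot all_order all_algebra.
From mathcomp Require Import complex.
From mathcomp Require Import all_classical all_reals all_analysis.
From mathcomp Require Import ring lra.

(* Let [phi] be a coherent rule for [F]. Since [phi 1 = F = phi F], it kills
   [1 - F], hence by positivity every [0 <= G <= c (1 - F)]. The operator
   [F - F^2] is positive and lies below both [F] and [1 - F], so [phi] both
   fixes and kills it: [F^2 = F].
   For uniqueness take [0 <= X <= c 1] and [r > 0]. The off-diagonal part of
   [X] is absorbed by
     [X <= (1 + r) F X F + (1 + r^-1) (1 - F) X (1 - F)];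
   [phi] fixes the first compression, which lies below [c F], and kills the
   second. Letting [r] tend to 0 gives [phi X <= F X F], and applying this to
   [c 1 + X] and [c 1 - X] for an arbitrary [X] gives equality. *)

Set Implicit Arguments.
Unset Strict Implicit.
Unset Printing Implicit Defensive.

Import Order.TTheory GRing.Theory Num.Theory.

Local Open Scope ring_scope.
Local Open Scope complex_scope.

(** * The underlying real inner product space *)

Section RealInnerProduct.
Variables (R : realType) (H : hilbertType R).
Implicit Types (x y z : H) (r : R).

(** The real part is symmetric and retains the norm, so later estimates become real arithmetic. *)
Definition rdot x y : R := complex.Re (inner x y).

Lemma rdotC x y : rdot x y = rdot y x.
Proof.
rewrite /rdot (hermC inner x y) expr0 mul1r.
have ReJ (z : R[i]) : complex.Re z^* = complex.Re z by case: z.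
exact: ReJ.
Qed.

Lemma rdotDl x y z : rdot (x + y) z = rdot x z + rdot y z.
Proof.
have ReD (a b : R[i]) : complex.Re (a + b) = complex.Re a + complex.Re b.
  by case: a b => ? ? [].
by rewrite /rdot linearDl ReD.
Qed.

Lemma rdotNl x y : rdot (- x) y = - rdot x y.
Proof.
have ReN (a : R[i]) : complex.Re (- a) = - complex.Re a by case: a.
by rewrite /rdot linearNl ReN.
Qed.

Lemma rdot0l x : rdot 0 x = 0.
Proof. by rewrite -(subrr x) rdotDl rdotNl subrr. Qed.

Lemma rdotZl r x y : rdot (r%:C *: x) y = r * rdot x y.
Proof.
have ReZ (a : R[i]) : complex.Re (r%:C * a) = r * complex.Re a.
  by case: a => a b /=; rewrite mul0r subr0.
by rewrite /rdot linearZl_LR ReZ.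
Qed.

Lemma rdotDr x y z : rdot x (y + z) = rdot x y + rdot x z.
Proof. by rewrite rdotC rdotDl !(rdotC x). Qed.

Lemma rdotNr x y : rdot x (- y) = - rdot x y.
Proof. by rewrite rdotC rdotNl (rdotC x). Qed.

Lemma rdotZr r x y : rdot x (r%:C *: y) = r * rdot x y.
Proof. by rewrite rdotC rdotZl (rdotC x). Qed.

Definition rdotE := (rdotDl, rdotDr, rdotNl, rdotNr, rdotZl, rdotZr).

Lemma inner_rdot x : inner x x = (rdot x x)%:C.
Proof. by rewrite /rdot RRe_real// realE dnorm_ge0. Qed.

Lemma rdot_ge0 x : 0 <= rdot x x.
Proof. by rewrite -lecR -inner_rdot dnorm_ge0. Qed.

Lemma rdot_eq0 x : rdot x x = 0 -> x = 0.
Proof.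
by move=> x0; apply/eqP; rewrite -(dnorm_eq0 inner) inner_rdot x0.
Qed.

Lemma sqr_norm_rdot x : `|x| ^+ 2 = (rdot x x)%:C.
Proof. by rewrite sqr_norm_inner inner_rdot. Qed.

End RealInnerProduct.

(** * The order on bounded self-adjoint operators *)

Section SelfAdjointOperators.
Variables (R : realType) (H : hilbertType R).
Implicit Types (X Y F : sa_op H) (x y : H) (r c : R).

Lemma sa_linear X : linear X.
Proof. by have /bounded_saP[] := sa_funP X. Qed.

HB.instance Definition _ X :=
  GRing.isLinear.Build R[i] H H *:%R X (sa_linear X).

Lemma saD X Y x : (X + Y) x = X x + Y x. Proof. by []. Qed.

Lemma saN X x : (- X) x = - X x. Proof. by []. Qed.

Lemma saZ r X x : (r *: X) x = r%:C *: X x. Proof. by []. Qed.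

Lemma sa1 x : sa_one H x = x. Proof. by []. Qed.

Lemma sharpE F X x : sharp F X x = F (X (F x)). Proof. by []. Qed.

Definition saE := (saD, saN, saZ, sa1, sharpE).

Lemma sa_ext X Y : X =1 Y -> X = Y.
Proof. by move=> XY; apply/val_inj/funext. Qed.

Lemma rdot_sa X x y : rdot (X x) y = rdot x (X y).
Proof. by have /bounded_saP[_ _ sX] := sa_funP X; rewrite /rdot sX. Qed.

(** Self-adjointness makes [inner (X x) x] equal to its conjugate, so its imaginary part
    vanishes. *)
Lemma sa_posP X : sa_pos X <-> forall x, 0 <= rdot (X x) x.
Proof.
split=> X0 x; have := X0 x; rewrite /rdot.
  by rewrite lecE => /andP[].
have ImJ (z : R[i]) : z = z^* -> complex.Im z = 0.
  by case: z => a b [] bN /=; lra.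
have /bounded_saP[_ _ sX] := sa_funP X.
have /ImJ Im0 : inner (X x) x = (inner (X x) x)^*.
  by have := hermC inner x (X x); rewrite expr0 mul1r => /(etrans (sX x x)).
by rewrite lecE Im0 eqxx.
Qed.

(** The form of [X] vanishes identically, and its value at [x + X x] is twice the squared norm of
    [X x]. *)
Lemma sa_pos_antisym X : sa_pos X -> sa_pos (- X) -> X = 0.
Proof.
move=> /sa_posP X0 /sa_posP X0'.
have Xxx x : rdot (X x) x = 0.
  by have := X0 x; have := X0' x; rewrite saE rdotE; lra.
apply: sa_ext => x; apply: rdot_eq0.
have := Xxx (x + X x); rewrite raddfD /= !rdotE.
rewrite (rdot_sa X (X x) x) !Xxx; lra.
Qed.

Lemma sa_le_scale_one X : exists2 c, 0 < c & sa_pos (c *: sa_one H - X).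
Proof.
have /bounded_saP[_ [M bX] _] := sa_funP X.
(* The absolute value covers a negative [M]; the added 1 makes the constant strictly positive. *)
have c0 : 0 < `|M| + 1 by rewrite ltr_wpDl.
exists (`|M| + 1) => //; apply/sa_posP => x; set c := `|M| + 1.
have XcX : rdot (X x) (X x) <= c ^+ 2 * rdot x x.
  rewrite -lecR rmorphM rmorphXn /= -!sqr_norm_rdot -exprMn.
  rewrite lerXn2r ?nnegrE ?normr_ge0 ?mulr_ge0 ?lecR ?(ltW c0)//.
  rewrite (le_trans (bX x))// ler_wpM2r// lecR /c.
  by rewrite ler_wpDr// ler_norm.
(* Expanding this square and inserting [XcX] bounds [2 * c * rdot (X x) x] by
   [2 * c ^+ 2 * rdot x x]; then [c] is cancelled. *)
have := rdot_ge0 (c%:C *: x - X x).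
rewrite !saE !rdotE (rdotC x (X x)) => h.
rewrite -(pmulr_rge0 _ c0) -/c; nra.
Qed.

(** * Compressions by effects and projections *)

Lemma rdot_sharp F X x : rdot (sharp F X x) x = rdot (X (F x)) (F x).
Proof. by rewrite sharpE rdot_sa. Qed.

Lemma sharp_pos F X : sa_pos X -> sa_pos (sharp F X).
Proof.
by move=> /sa_posP X0; apply/sa_posP => x; rewrite rdot_sharp; exact: X0.
Qed.

Lemma sharp_is_linear F : linear (sharp F).
Proof.
move=> r X Y; apply: sa_ext => x.
by rewrite !saE sa_linear.
Qed.

HB.instance Definition _ F :=
  GRing.isLinear.Build R (sa_op H) (sa_op H) *:%R (sharp F) (sharp_is_linear F).

(* This is the positivity of [X] at [r *: F x - (x - F x)]. *)
Lemma sharp_young F X r : 0 < r -> sa_pos X ->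
  sa_pos ((1 + r) *: sharp F X + (1 + r^-1) *: sharp (sa_one H - F) X - X).
Proof.
move=> r0 /sa_posP X0; apply/sa_posP => x.
have combE a b (A B C : sa_op H) : rdot ((a *: A + b *: B - C) x) x =
    a * rdot (A x) x + b * rdot (B x) x - rdot (C x) x.
  by rewrite !saE !rdotE.
have young u v : rdot (X (u + v)) (u + v) <=
    (1 + r) * rdot (X u) u + (1 + r^-1) * rdot (X v) v.
  have := X0 (r%:C *: u - v); rewrite !raddfD /= raddfN /= linearZ /= !rdotE.
  rewrite (rdot_sa X v u) (rdotC v).
  set a := rdot (X u) u; set b := rdot (X u) v; set d := rdot (X v) v => h.
  rewrite -subr_ge0 -(pmulr_rge0 _ r0).
  suff -> : r * ((1 + r) * a + (1 + r^-1) * d - (a + b + (b + d))) =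
    r * (r * a) - r * b - (r * b - d) by lra.
  by field; rewrite gt_eqF.
rewrite combE !rdot_sharp subr_ge0; have := young (F x) ((sa_one H - F) x).
by rewrite [(sa_one H - F) x]saE saN [F x + _]addrC subrK.
Qed.

(** This is F - F^2, with the square written as a compression of the identity so that it is
    self-adjoint by construction. *)
Definition sa_sub_sqr F : sa_op H := F - sharp F (sa_one H).

Lemma sa_sub_sqrE F x : sa_sub_sqr F x = F x - F (F x). Proof. by []. Qed.

(* [F - F^2 = F (1 - F) F + (1 - F) F (1 - F)] *)
Lemma sa_sub_sqr_pos F : is_effect F -> sa_pos (sa_sub_sqr F).
Proof.
move=> [/sa_posP F0 /sa_posP F1]; apply/sa_posP => x.
have := F0 (x - F x); have := F1 (F x).
rewrite sa_sub_sqrE subr0 !saE raddfB /= !rdotE.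
lra.
Qed.

(** The difference is F^2, whose form is the squared norm of [F x]. *)
Lemma sa_sub_sqr_le F : sa_le (sa_sub_sqr F) F.
Proof.
apply/sa_posP => x.
by rewrite saD saN sa_sub_sqrE opprB addrC subrK rdot_sa rdot_ge0.
Qed.

(** The difference is (1 - F)^2. *)
Lemma sa_sub_sqr_le_compl F : sa_le (sa_sub_sqr F) (sa_one H - F).
Proof.
apply/sa_posP => x; rewrite 2!saD !saN sa_sub_sqrE sa1.
have := rdot_ge0 (x - F x).
by rewrite !rdotE (rdotC x (F x)) (rdot_sa F (F x)); lra.
Qed.

Lemma projectionE F : is_projection F -> forall x, F (F x) = F x.
Proof. by move=> FF x; rewrite -[LHS]/((F \o F) x) FF. Qed.

Lemma compl_projection F : is_projection F -> is_projection (sa_one H - F).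
Proof.
move=> /projectionE FF; apply/funext => x.
rewrite -[LHS]/(x - F x - F (x - F x)) raddfB /=.
by rewrite FF subrr subr0.
Qed.

Lemma sharp_le_scale F X c : is_projection F ->
  sa_pos (c *: sa_one H - X) -> sa_pos (c *: F - sharp F X).
Proof.
move=> /projectionE FF /(sharp_pos F); rewrite linearB linearZ /=.
by congr sa_pos; congr (_ *: _ - _); apply: sa_ext => x; rewrite sharpE FF.
Qed.

(* The operator [G] vanishes on the range of [1 - F]: for [w = G v] with
   [F v = 0], positivity at [v - w] gives [2 |w|^2 <= <G w, w> <= |w|^2]. *)
Lemma sharp_id F G : is_projection F -> sa_pos G -> sa_le G F ->
  sharp F G = G.
Proof.
move=> /projectionE FF /sa_posP G0 /sa_posP GF.
have Gv v : F v = 0 -> G v = 0.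
  move=> Fv0; apply: rdot_eq0.
  set w := G v.
  have GwFw : rdot (G w) w <= rdot (F w) w.
    by rewrite -subr_ge0 -rdotNl -rdotDl; exact: GF.
  have Fww : rdot (F w) w <= rdot w w.
    have := rdot_ge0 (w - F w); rewrite !rdotE (rdotC w (F w)).
    by rewrite [rdot (F w) (F w)]rdot_sa FF (rdotC w (F w)); lra.
  have wv : rdot w v <= 0.
    by rewrite -(rdot0l v) -Fv0 -subr_ge0 -rdotNl -rdotDl; exact: GF.
  have := G0 (v - w); rewrite raddfB /= -/w !rdotE (rdot_sa G w v) -/w.
  by have := rdot_ge0 w; lra.
have GFx x : G (F x) = G x.
  have := Gv (F x - x); rewrite !raddfB /= FF subrr => /(_ erefl)/eqP.
  by rewrite subr_eq0 => /eqP.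
apply: sa_ext => x; rewrite sharpE GFx; apply/eqP; rewrite -subr_eq0; apply/eqP.
apply: rdot_eq0.
(* Taking adjoints in G F = G gives F G = G. *)
have FGy y z : rdot (F (G y)) z = rdot (G y) z.
  by rewrite 2!rdot_sa GFx -rdot_sa.
by rewrite rdotDl rdotNl FGy subrr.
Qed.

Lemma sharp_coherent F : is_effect F -> is_projection F ->
  coherent_luders F (sharp F).
Proof.
move=> eF FP; split => [||| G].
- exact: sharp_is_linear.
- exact: sharp_pos.
- by apply: sa_ext => x; rewrite sharpE (projectionE FP).
- exact: sharp_id.
Qed.

Lemma sa_pos_closed X Y :
  (forall r, 0 < r -> sa_pos (X + r *: Y)) -> sa_pos X.
Proof.
move=> XY; apply/sa_posP => x; set b := rdot (Y x) x.
have b0 : 0 < `|b| + 1 by rewrite ltr_wpDl.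
apply/ler_addgt0Pr => e e0.
(* With this [r] the perturbation [r * b] is at most [e]; the 1 keeps the denominator positive when
   [b] is 0. *)
have r0 : 0 < e / (`|b| + 1) by rewrite divr_gt0.
have /sa_posP/(_ x) := XY _ r0; rewrite !saE !rdotE -/b => /le_trans; apply.
rewrite lerD2l mulrAC ler_pdivrMr// ler_pM2l//.
by rewrite ler_wpDr// ler_norm.
Qed.

(** * Arbitrary coherent rules for a fixed effect *)

Section LudersRule.
Variables (F : sa_op H) (phi : sa_op H -> sa_op H).
Hypotheses (eF : is_effect F) (phiF : coherent_luders F phi).

Let phiL : linear phi. Proof. by case: phiF. Qed.

HB.instance Definition _ :=
  GRing.isLinear.Build R (sa_op H) (sa_op H) *:%R phi phiL.

Lemma luders_compl : phi (sa_one H - F) = 0.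
Proof.
case: phiF => _ _ phi1 phiG; rewrite linearB /= phi1 phiG ?subrr//.
- by case: eF => F0 _; rewrite /sa_le subr0 in F0.
- by apply/sa_posP => x; rewrite subrr rdot0l.
Qed.

(** Since [phi] kills 1 - F, it sends the second positive operator to [- phi G], while [phi G] is
    positive too. *)
Lemma luders_eq0 G c : sa_pos G -> sa_pos (c *: (sa_one H - F) - G) ->
  phi G = 0.
Proof.
case: phiF => _ phi0 _ _ G0 /phi0.
rewrite linearB linearZ /= luders_compl scaler0 sub0r.
by apply: sa_pos_antisym; exact: phi0.
Qed.

Lemma luders_projection : is_projection F.
Proof.
case: phiF => _ _ _ phiG.
have v0 := sa_sub_sqr_pos eF.
have : sa_sub_sqr F = 0.
  rewrite -(phiG _ v0 (sa_sub_sqr_le F)); apply: (@luders_eq0 _ 1) => //.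
  by rewrite scale1r; exact: sa_sub_sqr_le_compl.
move=> F2; apply/funext => x /=; apply/esym/eqP.
by rewrite -subr_eq0 -sa_sub_sqrE F2.
Qed.

(** Scaling by [c^-1] brings the compression below [F], where [phi] is the identity; linearity
    undoes the scaling. *)
Lemma luders_sharp X c : 0 < c -> sa_pos X -> sa_pos (c *: sa_one H - X) ->
  phi (sharp F X) = sharp F X.
Proof.
case: phiF => _ _ _ phiG c0 X0 Xc.
have ci : 0 < c^-1 by rewrite invr_gt0.
have posZ Y : sa_pos Y -> sa_pos (c^-1 *: Y).
  move=> /sa_posP Y0; apply/sa_posP => x.
  by rewrite saE rdotE mulr_ge0// ltW.
have /(congr1 ( *:%R c)) : phi (c^-1 *: sharp F X) = c^-1 *: sharp F X.
  apply: phiG; first by apply: posZ; exact: sharp_pos.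
  have /posZ := sharp_le_scale luders_projection Xc.
  by rewrite scalerBr scalerA mulVf ?scale1r// gt_eqF.
by rewrite linearZ /= !scalerA mulfV ?scale1r// gt_eqF.
Qed.

Lemma luders_le X c : 0 < c -> sa_pos X -> sa_pos (c *: sa_one H - X) ->
  sa_le (phi X) (sharp F X).
Proof.
move=> c0 X0 Xc; rewrite /sa_le.
(* The perturbation is the excess [r *: sharp F X] in the Young bound. *)
apply: (@sa_pos_closed _ (sharp F X)) => r r0.
case: (phiF) => _ /(_ _ (sharp_young F r0 X0)) + _ _.
rewrite linearB linearD !linearZ /= (luders_sharp c0)//.
rewrite (@luders_eq0 (sharp (sa_one H - F) X) c); first 1 last.
- exact: sharp_pos.
- exact: sharp_le_scale (compl_projection luders_projection) Xc.
by rewrite scaler0 addr0 scalerDl scale1r addrAC.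
Qed.

Lemma luders_eq_sharp : phi = sharp F.
Proof.
have sub X : sa_le (phi X) (sharp F X).
  have [a a0 Xa] := sa_le_scale_one X; have [b b0 Xb] := sa_le_scale_one (- X).
  have ab0 : 0 < a + b by rewrite addr_gt0.
  have X0 : sa_pos (X + b *: sa_one H) by rewrite addrC -[X]opprK.
  have Xab : sa_pos ((a + b) *: sa_one H - (X + b *: sa_one H)).
    by rewrite scalerDl opprD addrACA subrr addr0.
  have := luders_le ab0 X0 Xab; rewrite /sa_le !linearD !linearZ /=.
  (* Both maps send the identity to [F], so the shift by [b] cancels. *)
  case: (phiF) => _ _ -> _.
  case: (sharp_coherent eF luders_projection) => _ _ -> _.
  by rewrite scalerN addrACA subrr addr0.
apply/funext => X; apply/esym/eqP; rewrite -subr_eq0; apply/eqP.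
apply: sa_pos_antisym; first exact: sub.
by have := sub (- X); rewrite /sa_le !linearN /= opprK opprB addrC.
Qed.

End LudersRule.

End SelfAdjointOperators.

Theorem mainTheorem1 (R : realType) (H : hilbertType R) (F : sa_op H)
    (hF : is_effect F) :
  ((exists phi : sa_op H -> sa_op H, coherent_luders F phi) <-> is_projection F) /\
  (is_projection F ->
     coherent_luders F (sharp F) /\
     forall phi : sa_op H -> sa_op H, coherent_luders F phi -> phi = sharp F).
Proof.
split.
  split=> [[phi phiF]|FP]; first exact: luders_projection hF phiF.
  by exists (sharp F); exact: sharp_coherent.
move=> FP; split; first exact: sharp_coherent.
by move=> phi phiF; exact: luders_eq_sharp.
Qed.
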